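(* Let $N\ge 2$, let $\lambda,\omega\in\mathbb{R}$, and consider on the phase space $\{(\mathbf{q},\mathbf{p})\in\mathbb{R}^N\times\mathbb{R}^N : 1+\lambda\mathbf{q}^2\neq 0\}$, with canonical Poisson bracket $\{q_i,p_j\}=\delta_{ij}$, the Hamiltonian $$\mathcal{H}_\lambda(\mathbf{q},\mathbf{p})=\frac{\mathbf{p}^2}{2(1+\lambda\mathbf{q}^2)}+\frac{\omega^2\mathbf{q}^2}{2(1+\lambda\mathbf{q}^2)}.$$ Then: (i) For any real $\lambda$, $\mathcal{H}_\lambda$ has the following constants of motion (functions Poisson-commuting with $\mathcal{H}_\lambda$): - the $2N-3$ angular momentum integrals $$C^{(m)}=\sum_{1\le i<j\le m}(q_ip_j-q_jp_i)^2,\qquad C_{(m)}=\sum_{N-m<i<j\le N}(q_ip_j-q_jp_i)^2,\qquad m=2,\dots,N,$$ where $C^{(N)}=C_{(N)}$; - the $N^2$ integrals (the curved Fradkin tensor) $$I_{ij}=p_ip_j-\bigl(2\lambda\,\mathcal{H}_\lambda(\mathbf{q},\mathbf{p})-\omega^2\bigr)q_iq_j,\qquad i,j=1,\dots,N,$$ which satisfy $\mathcal{H}_\lambda=\frac12\sum_{i=1}^N I_{ii}$. (ii) Each of the three sets $\{\mathcal{H}_\lambda, C^{(m)} : m=2,\dots,N\}$, $\{\mathcal{H}_\lambda, C_{(m)} : m=2,\dots,N\}$ and $\{I_{ii} : i=1,\dots,N\}$ consists of $N$ functionally independent functions in involution. (iii) For any fixed index $i\in\{1,\dots,N\}$, the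 set $\{\mathcal{H}_\lambda, C^{(m)}, C_{(m)}, I_{ii} : m=2,\dots,N\}$ consists of $2N-1$ functionally independent functions (so $\mathcal{H}_\lambda$ is maximally superintegrable).
   Context: Here $\mathbf{q}^2=\sum_{i=1}^N q_i^2$ and $\mathbf{p}^2=\sum_{i=1}^N p_i^2$. Functional independence means the differentials of the functions are linearly independent on an open dense subset of the phase space; involution means pairwise vanishing Poisson brackets. *)

(* Defs.v *)
From HB Require Import structures.
From mathcomp Require Import all_boot all_order all_algebra.
From mathcomp Require Import all_classical all_reals all_analysis.
Set Implicit Arguments. Unset Strict Implicit. Unset Printing Implicit Defensive.
Import Order.TTheory GRing.Theory Num.Theory.
Import numFieldNormedType.Exports.
Local Open Scope classical_set_scope.
Local Open Scope ring_scope.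

Notation phase R N := ('rV[R]_N * 'rV[R]_N)%type.

Section Defs.
Variables (R : realType) (N : nat).
Local Notation phase := (phase R N).

Definition qc (x : phase) (i : 'I_N) : R := x.1 ord0 i.
Definition pc (x : phase) (i : 'I_N) : R := x.2 ord0 i.

Definition ev (i : 'I_N) : 'rV[R]_N := delta_mx ord0 i.

Definition dq (f : phase -> R) (i : 'I_N) (x : phase) : R :=
  derive1 (fun t : R => f (x.1 + t *: ev i, x.2)) 0.
Definition dp (f : phase -> R) (i : 'I_N) (x : phase) : R :=
  derive1 (fun t : R => f (x.1, x.2 + t *: ev i)) 0.

Definition pbracket (f g : phase -> R) (x : phase) : R :=
  \sum_(i < N) (dq f i x * dp g i x - dp f i x * dq g i x).

Definition grad (f : phase -> R) (x : phase) : 'rV[R]_(N + N) :=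
  row_mx (\row_i dq f i x) (\row_i dp f i x).

Definition jac (F : seq (phase -> R)) (x : phase) : 'M[R]_(size F, N + N) :=
  \matrix_(a < size F) grad (nth (fun _ => 0) F a) x.

Definition func_indep (D : set phase) (F : seq (phase -> R)) : Prop :=
  exists U : set phase, [/\ open U, U `<=` D, D `<=` closure U &
    forall x, U x -> row_free (jac F x)].

Definition in_involution (D : set phase) (F : seq (phase -> R)) : Prop :=
  forall a b : 'I_(size F), forall x, D x ->
    pbracket (nth (fun _ => 0) F a) (nth (fun _ => 0) F b) x = 0.

Definition sq_q (x : phase) : R := \sum_(i < N) qc x i ^+ 2.
Definition sq_p (x : phase) : R := \sum_(i < N) pc x i ^+ 2.

Variables (lam om : R).

Definition phase_space : set phase := [set x | 1 + lam * sq_q x != 0].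

Definition Ham (x : phase) : R :=
  sq_p x / (2 * (1 + lam * sq_q x)) + om ^+ 2 * sq_q x / (2 * (1 + lam * sq_q x)).

Definition Lsq (x : phase) (i j : 'I_N) : R :=
  (qc x i * pc x j - qc x j * pc x i) ^+ 2.

(* C^(m) = sum_{1 <= i < j <= m}, written with 0-based indices i < j < m *)
Definition Cup (m : nat) (x : phase) : R :=
  \sum_(i < N) \sum_(j < N | (i < j)%N && (j < m)%N) Lsq x i j.

(* C_(m) = sum_{N-m < i < j <= N}, written with 0-based indices N-m <= i < j *)
Definition Clow (m : nat) (x : phase) : R :=
  \sum_(i < N | (N - m <= i)%N) \sum_(j < N | (i < j)%N) Lsq x i j.

Definition Ifr (i j : 'I_N) (x : phase) : R :=
  pc x i * pc x j - (2 * lam * Ham x - om ^+ 2) * qc x i * qc x j.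

End Defs.

(* Main.v *)
(* Write Q_A, U_A, P_A for the sums of q_i^2, q_i p_i, p_i^2 over i in A. By
   Lagrange's identity every C^(m) and C_(m) has the form
   C_A = Q_A P_A - U_A^2, with gradient 2 (Q_A p_k - U_A q_k) in p_k and
   2 (P_A q_k - U_A p_k) in q_k for k in A; all brackets become polynomial
   identities once 2 lam H - om^2 is written as
   K = (lam p^2 - om^2) / (1 + lam q^2).

   A nonzero polynomial is nonzero on an open dense set, so independence only has
   to be derived from finitely many polynomial inequalities, each with its own
   witness point. Linear symplectic maps acting simultaneously on all (q_i, p_i)
   fix the angular momenta, and the corresponding vector fields eliminate the
   coefficients of H and I_ii from a linear relation between the gradients. In a
   remaining relation sum_m b_m dC^(m) + sum_m c_m dC_(m) = 0, the k-th components
   say that the quadratic form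
     T_k = sum_(m > k) b_m S_(i < m) + sum_(m >= N - k) c_m S_(i >= N - m),
   where S_A has entries Q_A, U_A, P_A, annihilates (p_k, - q_k). Passing from T_k
   to T_(k+1) changes only two terms, so generically T_k = 0 forces these two
   coefficients to vanish together with T_(k+1). *)

Require Import Defs.
From HB Require Import structures.
From mathcomp Require Import all_boot all_order all_algebra.
From mathcomp Require Import all_classical all_reals all_analysis.
From mathcomp Require Import ring lra zify.
Import Order.TTheory GRing.Theory Num.Theory.
Import numFieldNormedType.Exports.
Local Open Scope classical_set_scope.
Local Open Scope ring_scope.

(** * Generic nonvanishing of polynomial functions *)

Section Generic.
Context {R : realType} {V : normedModType R}.
Implicit Types (f g : V -> R) (U : set V).

(** Polynomiality is only required along each line, together with continuity; this replaces
    multivariate polynomials and is stable under sums and products. *)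
Definition polyfun f := continuous f /\
  forall x v : V, exists P : {poly R}, forall t : R, f (x + t *: v) = P.[t].

Lemma polyfun_cst (a : R) : polyfun (fun=> a).
Proof.
split=> [x|x v]; first exact: cvg_cst.
by exists a%:P => t; rewrite hornerC.
Qed.

Lemma polyfunD f g : polyfun f -> polyfun g -> polyfun (fun x => f x + g x).
Proof.
move=> [cf pf] [cg pg]; split=> [x|x v]; first by apply: cvgD; [exact: cf | exact: cg].
have [P HP] := pf x v; have [Q HQ] := pg x v.
by exists (P + Q) => t; rewrite hornerD HP HQ.
Qed.

Lemma polyfunM f g : polyfun f -> polyfun g -> polyfun (fun x => f x * g x).
Proof.
move=> [cf pf] [cg pg]; split=> [x|x v]; first by apply: cvgM; [exact: cf | exact: cg].
have [P HP] := pf x v; have [Q HQ] := pg x v.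
by exists (P * Q) => t; rewrite hornerM HP HQ.
Qed.

Lemma polyfunN f : polyfun f -> polyfun (fun x => - f x).
Proof.
move=> pf; have := polyfunM (fun=> -1) f (polyfun_cst _) pf.
by congr polyfun; apply/funext => x; rewrite mulN1r.
Qed.

Lemma polyfunB f g : polyfun f -> polyfun g -> polyfun (fun x => f x - g x).
Proof. by move=> pf pg; apply: polyfunD => //; exact: polyfunN. Qed.

Lemma polyfunX f n : polyfun f -> polyfun (fun x => f x ^+ n).
Proof.
move=> pf; elim: n => [|n IH]; first exact: polyfun_cst.
have := polyfunM _ _ pf IH.
by congr polyfun; apply/funext => x; rewrite exprS.
Qed.

Lemma polyfun_sum (I : Type) (r : seq I) (A : pred I) (F : I -> V -> R) :
  (forall i, polyfun (F i)) -> polyfun (fun x => \sum_(i <- r | A i) F i x).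
Proof.
move=> pF; elim: r => [|i r IH].
  have := polyfun_cst 0.
  by congr polyfun; apply/funext => x; rewrite big_nil.
case: (boolP (A i)) => Ai.
  have := polyfunD _ _ (pF i) IH.
  by congr polyfun; apply/funext => x; rewrite big_cons Ai.
move: IH; congr polyfun; apply/funext => x.
by rewrite big_cons (negbTE Ai).
Qed.

Definition generic U := open U /\ dense U.

Lemma genericT : generic setT.
Proof. by split; [exact: openT | move=> O O0 opO; rewrite setIT]. Qed.

Lemma genericI U1 U2 : generic U1 -> generic U2 -> generic (U1 `&` U2).
Proof.
move=> [opU1 dU1] [opU2 dU2]; split; first exact: openI.
exact: denseI.
Qed.

Lemma generic_forall (I : finType) (U : I -> set V) :
  (forall i, generic (U i)) -> generic [set x | forall i, U i x].
Proof.
move=> gU.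
have: generic [set x | forall i, i \in enum I -> U i x].
  elim: (enum I) => [|i r IH].
    by have := genericT; congr generic; apply/seteqP; split.
  have := genericI _ _ (gU i) IH; congr generic; apply/seteqP; split=> x /=.
    by move=> [Uix Ur] j; rewrite inE => /predU1P[-> //|]; exact: Ur.
  move=> Ux; split; first by apply: Ux; rewrite inE eqxx.
  by move=> j jr; apply: Ux; rewrite inE jr orbT.
congr generic; apply/seteqP; split=> x /= Ux i; last by move=> _; exact: Ux.
by apply: Ux; rewrite mem_enum.
Qed.

Lemma generic_imply (b : bool) U : (b -> generic U) ->
  generic [set x | b -> U x].
Proof.
case: b => gU.
  by have := gU erefl; congr generic; apply/seteqP; split=> x /=; auto.
by have := genericT; congr generic; apply/seteqP; split.
Qed.

Lemma poly_nonroot_small (P : {poly R}) (e : R) : 0 < e -> P != 0 ->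
  exists t : R, `|t| < e /\ P.[t] != 0.
Proof.
move=> e0 P0.
(* These are [size P] distinct points, more than a nonzero [P] can have roots; the shift by 2 keeps
   them strictly below [e]. *)
pose s := [seq e / (n.+2)%:R | n <- iota 0 (size P)].
have us : uniq s.
  rewrite map_inj_uniq ?iota_uniq// => m n /(mulfI (lt0r_neq0 e0))/invr_inj/eqP.
  by rewrite eqr_nat => /eqP[].
have [/(max_poly_roots P0)/(_ us)|/allPn[t /mapP[n _ ->] nr]] :=
    boolP (all (root P) s).
  by rewrite size_map size_iota ltnn.
exists (e / n.+2%:R); split; last exact: nr.
rewrite ger0_norm ?divr_ge0 ?ltW// ltr_pdivrMr ?ltr0n// ltr_pMr//.
by rewrite ltr1n.
Qed.

(* Restricted to the segment from an arbitrary point to [y], [f] becomes a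
   nonzero univariate polynomial, which has only finitely many roots. *)
Lemma generic_polyfun f (y : V) : polyfun f -> f y != 0 ->
  generic [set x | f x != 0].
Proof.
move=> [cf pf] fy; split.
  have -> : [set x | f x != 0] = f @^-1` [set z | z != 0] by [].
  by apply: open_comp; [move=> x _; exact: cf | exact: open_neq].
move=> O [x Ox] opO; have [P HP] := pf x (y - x).
have P0 : P != 0.
  apply: contra_neq fy => P0.
  have := HP 1; rewrite P0 horner0 scale1r.
  by have -> : x + (y - x) = y by rewrite addrC subrK.
have : (fun t : R => x + t *: (y - x)) @ (0 : R) --> x.
  have : (fun t : R => x + t *: (y - x)) @ (0 : R) --> x + 0 *: (y - x).
    by apply: cvgD; [exact: cvg_cst | apply: cvgZr_tmp; exact: cvg_id].
  by rewrite scale0r addr0.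
move=> /(_ O) ; have /[swap]/[apply] : nbhs x O by exact: open_nbhs_nbhs.
move=> /nbhs_ballP[e /= e0 eO].
have [t [te Pt]] := poly_nonroot_small P e e0 P0.
exists (x + t *: (y - x)); split; last by rewrite /= HP.
by apply: eO; rewrite /ball /= sub0r normrN.
Qed.

End Generic.

(** * Gradients of the integrals *)

Section Derivatives.
Context {R : realType} {N : nat}.
Local Notation phase := (phase R N).
Implicit Types (x v : phase) (f g : phase -> R) (A B : pred 'I_N).

(** The difference quotient is constantly [a] away from 0. This serves the coordinate functions. *)
Lemma is_derive_affine f x v (a : R) :
  (forall h : R, f (h *: v + x) = f x + h * a) -> is_derive x v f a.
Proof.
move=> fa.
have cva : (fun h : R => h^-1 *: (f (h *: v + x) - f x)) @ 0^' --> a.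
  apply: cvg_near_cst; near=> h.
  rewrite fa [f x + _]addrC addrK /GRing.scale /= mulKf//.
  by near: h; exact: nbhs_dnbhs_neq.
by apply: DeriveDef; [apply/cvg_ex; exists a | exact/cvg_lim].
Unshelve. all: by end_near. Qed.

Lemma is_derive_qc x v i : is_derive x v (fun y => qc y i) (qc v i).
Proof. by apply: is_derive_affine => h; rewrite /qc /= !mxE addrC. Qed.

Lemma is_derive_pc x v i : is_derive x v (fun y => pc y i) (pc v i).
Proof. by apply: is_derive_affine => h; rewrite /pc /= !mxE addrC. Qed.

Lemma is_derive_mul f g x v a b : is_derive x v f a -> is_derive x v g b ->
  is_derive x v (fun y => f y * g y) (f x * b + g x * a).
Proof. exact: is_deriveM. Qed.

Lemma is_derive_add f g x v a b : is_derive x v f a -> is_derive x v g b ->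
  is_derive x v (fun y => f y + g y) (a + b).
Proof. exact: is_deriveD. Qed.

Lemma is_derive_sub f g x v a b : is_derive x v f a -> is_derive x v g b ->
  is_derive x v (fun y => f y - g y) (a - b).
Proof. exact: is_deriveB. Qed.

Lemma is_derive_scale (c : R) f x v a : is_derive x v f a ->
  is_derive x v (fun y => c * f y) (c * a).
Proof. exact: is_deriveZ. Qed.

Lemma is_derive_const (c : R) x v : is_derive x v (fun=> c) 0.
Proof. exact: is_derive_cst. Qed.

Lemma is_derive_pred_sum A (F : 'I_N -> phase -> R) (d : 'I_N -> R) x v :
  (forall i, is_derive x v (F i) (d i)) ->
  is_derive x v (fun y => \sum_(i | A i) F i y) (\sum_(i | A i) d i).
Proof.
move=> dF; elim: (index_enum _) => [|i r IH].
  rewrite big_nil (_ : (fun _ => _) = cst 0); first exact: is_derive_cst.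
  by apply/funext => y; rewrite big_nil.
rewrite big_cons; case: (boolP (A i)) => Ai.
  rewrite (_ : (fun _ => _) =
    (fun y => F i y + \sum_(i <- r | A i) F i y)); first exact: is_deriveD.
  by apply/funext => y; rewrite big_cons Ai.
rewrite (_ : (fun _ => _) = (fun y => \sum_(i <- r | A i) F i y)) //.
by apply/funext => y; rewrite big_cons (negbTE Ai).
Qed.

Lemma is_derive_quot f g x v a b : g x != 0 ->
  is_derive x v f a -> is_derive x v g b ->
  is_derive x v (fun y => f y / g y) ((a * g x - f x * b) / g x ^+ 2).
Proof.
move=> gx df dg.
have dV : is_derive x v (fun y => (g y)^-1) (- g x ^- 2 * b).
  apply: DeriveDef; first by apply: derivableV => //; exact: ex_derive.
  by rewrite deriveV// derive_val.
have := is_derive_mul _ _ _ _ _ _ df dV.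
by congr is_derive; field.
Qed.

Definition qdir (k : 'I_N) : phase := (ev R k, 0).
Definition pdir (k : 'I_N) : phase := (0, ev R k).

(** Bridge from directional derivatives on the product space, which obey the calculus rules, to the
    partial derivatives of the statement. *)
Lemma dqE f k x a : is_derive x (qdir k) f a -> dq f k x = a.
Proof.
move=> df; rewrite /dq derive1E -(derive_val (is_derive := df)) /derive.
set F := (F in lim (F @ _) = _).
have -> : F = (fun h : R => h^-1 *: ((f \o shift x) (h *: qdir k) - f x)) => //.
apply/funext => h; rewrite /F /=.
rewrite /shift /= addr0 scale0r addr0 -!surjective_pairing /GRing.scale /= mulr1.
by congr (_ * (f _ - _)); rewrite [RHS]surjective_pairing /= addrC scaler0 add0r.
Qed.

Lemma dpE f k x a : is_derive x (pdir k) f a -> dp f k x = a.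
Proof.
move=> df; rewrite /dp derive1E -(derive_val (is_derive := df)) /derive.
set F := (F in lim (F @ _) = _).
have -> : F = (fun h : R => h^-1 *: ((f \o shift x) (h *: pdir k) - f x)) => //.
apply/funext => h; rewrite /F /=.
rewrite /shift /= addr0 scale0r addr0 -!surjective_pairing /GRing.scale /= mulr1.
by congr (_ * (f _ - _)); rewrite [RHS]surjective_pairing /= [_ *: _ + x.2]addrC scaler0 add0r.
Qed.

Lemma qc_qdir k i : qc (qdir k) i = (i == k)%:R.
Proof. by rewrite /qc /= mxE. Qed.
Lemma pc_qdir k i : pc (qdir k) i = 0.
Proof. by rewrite /pc /= mxE. Qed.
Lemma qc_pdir k i : qc (pdir k) i = 0.
Proof. by rewrite /qc /= mxE. Qed.
Lemma pc_pdir k i : pc (pdir k) i = (i == k)%:R.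
Proof. by rewrite /pc /= mxE. Qed.

Definition SQ A x : R := \sum_(i | A i) qc x i ^+ 2.
Definition SU A x : R := \sum_(i | A i) qc x i * pc x i.
Definition SP A x : R := \sum_(i | A i) pc x i ^+ 2.

Lemma is_derive_SQ A x v :
  is_derive x v (SQ A) (\sum_(i | A i) 2 * qc x i * qc v i).
Proof.
apply: is_derive_pred_sum => i; rewrite (_ : _ * _ = qc x i * qc v i + qc x i * qc v i).
  by have := is_derive_mul _ _ _ _ _ _ (is_derive_qc x v i) (is_derive_qc x v i).
by ring.
Qed.

Lemma is_derive_SP A x v :
  is_derive x v (SP A) (\sum_(i | A i) 2 * pc x i * pc v i).
Proof.
apply: is_derive_pred_sum => i; rewrite (_ : _ * _ = pc x i * pc v i + pc x i * pc v i).
  by have := is_derive_mul _ _ _ _ _ _ (is_derive_pc x v i) (is_derive_pc x v i).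
by ring.
Qed.

Lemma is_derive_SU A x v :
  is_derive x v (SU A) (\sum_(i | A i) (qc x i * pc v i + pc x i * qc v i)).
Proof.
apply: is_derive_pred_sum => i.
exact: is_derive_mul (is_derive_qc x v i) (is_derive_pc x v i).
Qed.

Lemma sum_delta A k (F : 'I_N -> R) :
  \sum_(i | A i) F i * (i == k)%:R = (A k)%:R * F k.
Proof.
rewrite big_mkcond (bigD1 k)//= big1 ?addr0 => [|i /negbTE ->].
  by rewrite eqxx mulr1; case: (A k); rewrite ?mul1r ?mul0r.
by rewrite mulr0; case: (A i).
Qed.

(** Gram determinant of the restrictions of q and p to [A], equivalently the Casimir of the sl(2)
    spanned by [SQ A], [SU A] and [SP A]. *)
Definition cas A x : R := SQ A x * SP A x - SU A x ^+ 2.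

Lemma is_derive_cas A x v : is_derive x v (cas A)
  (\sum_(i | A i) 2 * ((SQ A x * pc x i - SU A x * qc x i) * pc v i
                       + (SP A x * qc x i - SU A x * pc x i) * qc v i)).
Proof.
rewrite /cas.
have dQ := is_derive_SQ A x v; have dP := is_derive_SP A x v.
have dU := is_derive_SU A x v.
have := is_derive_sub _ _ _ _ _ _
  (is_derive_mul _ _ _ _ _ _ dQ dP) (is_derive_mul _ _ _ _ _ _ dU dU).
congr is_derive.
rewrite !mulr_sumr -!big_split -sumrB /=.
by apply: eq_bigr => i _; ring.
Qed.

Lemma dq_cas A k x :
  dq (cas A) k x = (A k)%:R * (2 * (SP A x * qc x k - SU A x * pc x k)).
Proof.
rewrite (dqE _ _ _ _ (is_derive_cas A x _)).
rewrite -(sum_delta A k (fun i => 2 * (SP A x * qc x i - SU A x * pc x i))).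
by apply: eq_bigr => i _; rewrite pc_qdir qc_qdir mulr0 add0r mulrA.
Qed.

Lemma dp_cas A k x :
  dp (cas A) k x = (A k)%:R * (2 * (SQ A x * pc x k - SU A x * qc x k)).
Proof.
rewrite (dpE _ _ _ _ (is_derive_cas A x _)).
rewrite -(sum_delta A k (fun i => 2 * (SQ A x * pc x i - SU A x * qc x i))).
by apply: eq_bigr => i _; rewrite pc_pdir qc_pdir mulr0 addr0 mulrA.
Qed.

(** The diagonal contributes nothing and the two off-diagonal halves agree by exchanging the
    indices. *)
Lemma sum_ordered_pairs A (F : 'I_N -> 'I_N -> R) :
  (forall i j, F i j = F j i) -> (forall i, F i i = 0) ->
  \sum_(i | A i) \sum_(j | A j) F i j =
  2 * \sum_(i | A i) \sum_(j < N | (i < j)%N && A j) F i j.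
Proof.
move=> Fs F0.
have gt : \sum_(i | A i) \sum_(j < N | (j < i)%N && A j) F i j =
          \sum_(i | A i) \sum_(j < N | (i < j)%N && A j) F i j.
  rewrite (exchange_big_dep A) => [|i j _ /andP[]//]; apply: eq_bigr => i Ai.
  by apply: eq_big => j *; [rewrite Ai andbT andbC | rewrite Fs].
rewrite mulr_natl mulr2n -{1}gt -big_split; apply: eq_bigr => i _ /=.
rewrite (bigID (fun j : 'I_N => (j < i)%N)) /=; congr (_ + _).
  by apply: eq_bigl => j; rewrite andbC.
rewrite (bigID (fun j : 'I_N => (i < j)%N)) /= [X in _ + X]big1 ?addr0.
  by apply: eq_bigl => j; lia.
by move=> j /andP[/andP[_ ij] ji]; rewrite (_ : j = i) ?F0//; apply: val_inj => /=; lia.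
Qed.

(** Lagrange's identity. Doubling both sides turns the sum over ordered pairs into a full double
    sum, where the products of sums distribute. *)
Lemma sum_Lsq_cas A x :
  \sum_(i | A i) \sum_(j < N | (i < j)%N && A j) Lsq x i j = cas A x.
Proof.
apply: (@mulfI _ 2); first by rewrite pnatr_eq0.
rewrite -sum_ordered_pairs; first last.
- by move=> i; rewrite /Lsq subrr expr0n.
- by move=> i j; rewrite /Lsq; ring.
have -> : 2 * cas A x = SQ A x * SP A x + SP A x * SQ A x
                        + (- 2) * (SU A x * SU A x) by rewrite /cas; ring.
rewrite /SQ /SP /SU !big_distrlr /= mulr_sumr -!big_split.
apply: eq_bigr => i _; rewrite mulr_sumr -!big_split.
by apply: eq_bigr => j _; rewrite /Lsq /=; ring.
Qed.

Definition low m : pred 'I_N := fun i => (i < m)%N.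
Definition high m : pred 'I_N := fun i => (N - m <= i)%N.

Lemma Cup_cas m : Cup m = cas (low m) :> (phase -> R).
Proof.
apply/funext => x; rewrite -sum_Lsq_cas /Cup [RHS]big_mkcond /=.
apply: eq_bigr => i _; rewrite /low; case: ltnP => // mi.
by rewrite big1 // => j; lia.
Qed.

Lemma Clow_cas m : Clow m = cas (high m) :> (phase -> R).
Proof.
apply/funext => x; rewrite -sum_Lsq_cas /Clow; apply: eq_bigr => i Ai.
by apply: eq_bigl => j; rewrite /high; lia.
Qed.

End Derivatives.

(** * Poisson brackets *)

Section Brackets.
Context {R : realType} {N : nat}.
Variables (lam om : R).
Local Notation phase := (phase R N).
Local Notation T := (@predT 'I_N).
Implicit Types (x v : phase) (f g : phase -> R) (A B : pred 'I_N).

Definition conf x : R := 1 + lam * SQ T x.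
Definition curv x : R := (lam * SP T x - om ^+ 2) / conf x.

Lemma HamE x : Ham lam om x = (SP T x + om ^+ 2 * SQ T x) / (2 * conf x).
Proof. by rewrite /Ham -mulrDl. Qed.

Lemma curvE x : conf x != 0 -> 2 * lam * Ham lam om x - om ^+ 2 = curv x.
Proof.
by move=> W0; rewrite HamE /curv; move: W0; rewrite /conf => W0; field.
Qed.

Lemma is_derive_Ham x v : conf x != 0 -> is_derive x v (Ham lam om)
  ((\sum_i pc x i * pc v i - curv x * \sum_i qc x i * qc v i) / conf x).
Proof.
move=> W0.
have dQ := is_derive_SQ T x v; have dP := is_derive_SP T x v.
have dnum := is_derive_add _ _ _ _ _ _ dP (is_derive_scale (om ^+ 2) _ _ _ _ dQ).
have dden := is_derive_scale 2 _ _ _ _ (is_derive_add _ _ _ _ _ _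
  (is_derive_const 1 x v) (is_derive_scale lam _ _ _ _ dQ)).
have W2 : 2 * conf x != 0 by rewrite mulf_neq0 ?pnatr_eq0.
have := is_derive_quot _ _ _ _ _ _ W2 dnum dden.
rewrite (_ : (fun _ => _) = Ham lam om).
  congr is_derive; rewrite /curv add0r /=.
  have -> : \sum_(i | T i) 2 * qc x i * qc v i = 2 * \sum_i qc x i * qc v i.
    by rewrite mulr_sumr; apply: eq_bigr => i _; rewrite mulrA.
  have -> : \sum_(i | T i) 2 * pc x i * pc v i = 2 * \sum_i pc x i * pc v i.
    by rewrite mulr_sumr; apply: eq_bigr => i _; rewrite mulrA.
  by move: W0; rewrite /conf => W0; field.
by apply/funext => y; rewrite HamE.
Qed.

Lemma is_derive_Ifr x v i j : conf x != 0 -> is_derive x v (Ifr lam om i j)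
  (pc v i * pc x j + pc x i * pc v j
   - curv x * (qc v i * qc x j + qc x i * qc v j)
   - 2 * lam * qc x i * qc x j / conf x
     * (\sum_i pc x i * pc v i - curv x * \sum_i qc x i * qc v i)).
Proof.
move=> W0; have dH := is_derive_Ham x v W0.
have dpp := is_derive_mul _ _ _ _ _ _ (is_derive_pc x v i) (is_derive_pc x v j).
have dK := is_derive_sub _ _ _ _ _ _ (is_derive_scale (2 * lam) _ _ _ _ dH)
  (is_derive_const (om ^+ 2) x v).
have dKq := is_derive_mul _ _ _ _ _ _ dK (is_derive_qc x v i).
have := is_derive_sub _ _ _ _ _ _ dpp
  (is_derive_mul _ _ _ _ _ _ dKq (is_derive_qc x v j)).
congr is_derive; rewrite curvE //.
by ring.
Qed.

Lemma sum_pick k (F : 'I_N -> R) : \sum_i F i * (i == k)%:R = F k.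
Proof. by have := sum_delta T k F; rewrite mul1r. Qed.

Lemma sum_dir k x :
  ((\sum_i qc x i * qc (qdir k) i = qc x k)
   * (\sum_i pc x i * pc (qdir k) i = 0)
   * (\sum_i qc x i * qc (pdir k) i = 0)
   * (\sum_i pc x i * pc (pdir k) i = pc x k))%type.
Proof.
do !split.
- by rewrite -[RHS]sum_pick; apply: eq_bigr => i _; rewrite qc_qdir.
- by apply: big1 => i _; rewrite pc_qdir mulr0.
- by apply: big1 => i _; rewrite qc_pdir mulr0.
- by rewrite -[RHS]sum_pick; apply: eq_bigr => i _; rewrite pc_pdir.
Qed.

Lemma dq_Ham k x : conf x != 0 ->
  dq (Ham lam om) k x = - (curv x * qc x k / conf x).
Proof.
move=> W0; rewrite (dqE _ _ _ _ (is_derive_Ham x _ W0)).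
by rewrite !sum_dir sub0r mulNr.
Qed.

Lemma dp_Ham k x : conf x != 0 -> dp (Ham lam om) k x = pc x k / conf x.
Proof.
move=> W0; rewrite (dpE _ _ _ _ (is_derive_Ham x _ W0)).
by rewrite !sum_dir mulr0 subr0.
Qed.

Lemma dq_Ifr i j k x : conf x != 0 -> dq (Ifr lam om i j) k x =
  - curv x * ((i == k)%:R * qc x j + qc x i * (j == k)%:R
              - 2 * lam * qc x i * qc x j / conf x * qc x k).
Proof.
move=> W0; rewrite (dqE _ _ _ _ (is_derive_Ifr x _ i j W0)).
by rewrite !sum_dir !pc_qdir !qc_qdir; ring.
Qed.

Lemma dp_Ifr i j k x : conf x != 0 -> dp (Ifr lam om i j) k x =
  (i == k)%:R * pc x j + pc x i * (j == k)%:R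
  - 2 * lam * qc x i * qc x j / conf x * pc x k.
Proof.
move=> W0; rewrite (dpE _ _ _ _ (is_derive_Ifr x _ i j W0)).
by rewrite !sum_dir !pc_pdir !qc_pdir; ring.
Qed.

Lemma sum_quad A x (a b c : R) :
  \sum_i (A i)%:R * (a * qc x i ^+ 2 + b * (qc x i * pc x i) + c * pc x i ^+ 2)
  = a * SQ A x + b * SU A x + c * SP A x.
Proof.
rewrite /SQ /SU /SP !mulr_sumr -!big_split [RHS]big_mkcond.
by apply: eq_bigr => i _ /=; case: (A i); rewrite ?mul1r ?mul0r.
Qed.

(** This and the next two lemmas express the invariance of [cas A] under the shear p + tq, the shear
    q + tp and the scaling of q against p. *)
Lemma sum_q_dp_cas A x : \sum_k qc x k * dp (cas A) k x = 0.
Proof.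
transitivity (- 2 * SU A x * SQ A x + 2 * SQ A x * SU A x + 0 * SP A x); last ring.
by rewrite -sum_quad; apply: eq_bigr => k _; rewrite dp_cas; ring.
Qed.

Lemma sum_p_dq_cas A x : \sum_k pc x k * dq (cas A) k x = 0.
Proof.
transitivity (0 * SQ A x + 2 * SP A x * SU A x + - 2 * SU A x * SP A x); last ring.
by rewrite -sum_quad; apply: eq_bigr => k _; rewrite dq_cas; ring.
Qed.

Lemma sum_qdq_pdp_cas A x :
  \sum_k (qc x k * dq (cas A) k x - pc x k * dp (cas A) k x) = 0.
Proof.
transitivity (2 * SP A x * SQ A x + 0 * SU A x + - 2 * SQ A x * SP A x); last ring.
by rewrite -sum_quad; apply: eq_bigr => k _; rewrite dq_cas dp_cas; ring.
Qed.

Lemma pbracketC f g x : pbracket f g x = - pbracket g f x.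
Proof. by rewrite /pbracket -sumrN; apply: eq_bigr => k _; ring. Qed.

Lemma pbracket_self f x : pbracket f f x = 0.
Proof. by rewrite /pbracket big1// => k _; ring. Qed.

(** The Hamiltonian depends on [SQ T] and [SP T] only, so its Hamiltonian field is at each point a
    combination of the two shears. *)
Lemma pbracket_Ham_cas A x : conf x != 0 -> pbracket (Ham lam om) (cas A) x = 0.
Proof.
move=> W0.
transitivity (- (curv x / conf x) * \sum_k qc x k * dp (cas A) k x
              - (conf x)^-1 * \sum_k pc x k * dq (cas A) k x).
  rewrite !mulr_sumr -sumrB; apply: eq_bigr => k _.
  by rewrite dq_Ham// dp_Ham//; ring.
by rewrite sum_q_dp_cas sum_p_dq_cas !mulr0 subr0.
Qed.

(** Only indices in [A] contribute, and there both gradients are present. The sum becomes a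
    combination of [SQ A], [SU A] and [SP A] whose terms cancel. *)
Lemma pbracket_cas_sub A B x : (forall i, A i -> B i) ->
  pbracket (cas A) (cas B) x = 0.
Proof.
move=> AB; rewrite /pbracket.
transitivity ((- 4 * SP A x * SU B x + 4 * SU A x * SP B x) * SQ A x
  + (4 * SP A x * SQ B x - 4 * SQ A x * SP B x) * SU A x
  + (- 4 * SU A x * SQ B x + 4 * SQ A x * SU B x) * SP A x); last ring.
rewrite -sum_quad; apply: eq_bigr => k _; rewrite !dq_cas !dp_cas.
case: (boolP (A k)) => [/AB->|_]; last by rewrite !mul0r subrr.
by rewrite !mul1r; ring.
Qed.

Lemma pbracket_Ham_Ifr i j x : conf x != 0 ->
  pbracket (Ham lam om) (Ifr lam om i j) x = 0.
Proof.
move=> W0; rewrite /pbracket.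
(* The parts of the gradient of [Ifr] parallel to that of [Ham] drop out; the terms at k = i and k =
   j are opposite. *)
transitivity (curv x / conf x *
  \sum_k ((pc x k * qc x j - qc x k * pc x j) * (k == i)%:R
          + (qc x i * pc x k - pc x i * qc x k) * (k == j)%:R)).
  rewrite mulr_sumr; apply: eq_bigr => k _.
  by rewrite dq_Ham// dp_Ham// dq_Ifr// dp_Ifr// ![k == _]eq_sym; ring.
by rewrite big_split/= !sum_pick; ring.
Qed.

(** In each plane (q_k, p_k) both gradients are multiples of (- K q_k, p_k) with K = [curv x], so
    every summand vanishes separately. *)
Lemma pbracket_Ifr_diag i j x : conf x != 0 ->
  pbracket (Ifr lam om i i) (Ifr lam om j j) x = 0.
Proof.
move=> W0; have [->|ij] := eqVneq i j; first exact: pbracket_self.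
rewrite /pbracket big1// => k _; rewrite !dq_Ifr// !dp_Ifr//.
case: (eqVneq i k) ij => [->|_ _].
  by rewrite eq_sym => /negbTE ->; rewrite /=; ring.
by case: (eqVneq j k) => [->|_] /=; ring.
Qed.

Lemma Ham_trace x : conf x != 0 ->
  Ham lam om x = 2^-1 * \sum_i Ifr lam om i i x.
Proof.
move=> W0; transitivity (2^-1 * (SP T x - curv x * SQ T x)).
  by rewrite HamE /curv; move: W0; rewrite /conf => W0; field.
rewrite mulr_sumr -sumrB; congr (_ * _); apply: eq_bigr => i _.
by rewrite /Ifr curvE//; ring.
Qed.

End Brackets.

(** * Gradient independence *)

Section Independence.
Context {R : realType} {N : nat}.
Local Notation phase := (phase R N).
Local Notation T := (@predT 'I_N).
Implicit Types (x : phase) (F : seq (phase -> R)) (A : pred 'I_N).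

(** Coefficients are indexed by [nat] so that consing and concatenating families merely shifts the
    index. *)
Definition lincomb (a : nat -> R) F (g : (phase -> R) -> R) : R :=
  \sum_(0 <= n < size F) a n * g (nth (fun _ => 0) F n).

Lemma lincomb_cons a f F g :
  lincomb a (f :: F) g = a 0%N * g f + lincomb (fun n => a n.+1) F g.
Proof. by rewrite /lincomb /= big_nat_recl. Qed.

Lemma lincomb_cat a F G g : lincomb a (F ++ G) g =
  lincomb a F g + lincomb (fun n => a (size F + n)%N) G g.
Proof.
elim: F a => [|f F IH] a; first by rewrite /lincomb /= [X in _ = X + _]big_nil add0r.
by rewrite /= !lincomb_cons IH addrA.
Qed.

Lemma lincomb_map_iota a (C : nat -> phase -> R) k n g :
  lincomb a [seq C m | m <- iota k n] g =
  \sum_(k <= m < n + k) a (m - k)%N * g (C m).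
Proof.
rewrite /lincomb size_map size_iota -{2}[k]add0n big_addn addnK.
apply: eq_big_nat => i /andP[_ ilt].
by rewrite (nth_map 0%N) ?size_iota// nth_iota// addnK addnC.
Qed.

Lemma row_free_jac F x :
  (forall a : nat -> R,
    (forall k, lincomb a F (fun f => dq f k x) = 0) ->
    (forall k, lincomb a F (fun f => dp f k x) = 0) ->
    forall n, (n < size F)%N -> a n = 0) ->
  row_free (jac F x).
Proof.
move=> indep; rewrite -kermx_eq0; apply/eqP/row_matrixP => r.
set v := row r _; have vJ : v *m jac F x = 0.
  by apply/sub_kermxP; exact: row_sub.
(* The kernel vector is extended by 0 beyond the size of the family. *)
pose a n := oapp (v ord0) 0 (insub n).
have aE (i : 'I_(size F)) : a i = v ord0 i by rewrite /a valK.
have vE (l : 'I_(N + N)) : \sum_(i < size F) a i * jac F x i l = 0.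
  have := congr1 (fun M : 'rV[R]__ => M ord0 l) vJ; rewrite !mxE => {2}<-.
  by apply: eq_bigr => i _; rewrite aE.
apply/rowP => i; rewrite row0 [RHS]mxE -aE; apply: indep => // k.
- rewrite /lincomb big_mkord -[RHS](vE (lshift N k)); apply: eq_bigr => j _.
  by rewrite mxE row_mxEl mxE.
- rewrite /lincomb big_mkord -[RHS](vE (rshift N k)); apply: eq_bigr => j _.
  by rewrite mxE row_mxEr mxE.
Qed.

Lemma continuous_qc (i : 'I_N) : continuous (fun x => qc x i).
Proof.
move=> x; apply: (continuous_comp (f := fst) (g := fun v : 'rV[R]_N => v ord0 i)).
  exact: cvg_fst.
exact: coord_continuous.
Qed.

Lemma continuous_pc (i : 'I_N) : continuous (fun x => pc x i).
Proof.
move=> x; apply: (continuous_comp (f := snd) (g := fun v : 'rV[R]_N => v ord0 i)).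
  exact: cvg_snd.
exact: coord_continuous.
Qed.

Lemma polyfun_qc i : polyfun (fun x => qc x i).
Proof.
split=> [|x v]; first exact: continuous_qc.
exists ((qc x i)%:P + (qc v i)%:P * 'X) => t.
by rewrite !hornerE /qc /= !mxE mulrC.
Qed.

Lemma polyfun_pc i : polyfun (fun x => pc x i).
Proof.
split=> [|x v]; first exact: continuous_pc.
exists ((pc x i)%:P + (pc v i)%:P * 'X) => t.
by rewrite !hornerE /pc /= !mxE mulrC.
Qed.

Lemma polyfun_SQ A : polyfun (SQ A : phase -> R).
Proof. by apply: polyfun_sum => i; apply: polyfunX; exact: polyfun_qc. Qed.

Lemma polyfun_SP A : polyfun (SP A : phase -> R).
Proof. by apply: polyfun_sum => i; apply: polyfunX; exact: polyfun_pc. Qed.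

Lemma polyfun_SU A : polyfun (SU A : phase -> R).
Proof.
apply: polyfun_sum => i.
by apply: polyfunM; [exact: polyfun_qc | exact: polyfun_pc].
Qed.

(** A set that is open and dense in the whole space stays dense in the phase space because the
    latter is open. *)
Lemma func_indep_generic lam F (U : set phase) : generic U ->
  (forall x, conf lam x != 0 -> U x -> row_free (jac F x)) ->
  func_indep (phase_space lam) F.
Proof.
move=> [opU dU] free; have opD : open (phase_space (R:=R) (N:=N) lam).
  have -> : phase_space lam = conf lam @^-1` [set z | z != 0] :> set phase by [].
  apply: open_comp; last exact: open_neq.
  move=> x _; suff [cW _] : polyfun (conf lam : phase -> R) by exact: cW.
  apply: polyfunD; first exact: polyfun_cst.
  by apply: polyfunM; [exact: polyfun_cst | exact: polyfun_SQ].
exists (U `&` phase_space lam); split.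
- exact: openI.
- exact: subIsetr.
- move=> x Dx B /=; rewrite nbhsE /= => -[G [opG Gx] GB].
  have [y [[Gy Dy] Uy]] : ((G `&` phase_space lam) `&` U) !=set0.
    by apply: dU; [exists x | exact: openI].
  by exists y; split; [split | exact: GB].
- by move=> x [Ux Dx]; exact: free.
Qed.

Definition pt (q p : 'I_N -> R) : phase := (\row_i q i, \row_i p i).

Lemma qc_pt q p i : qc (pt q p) i = q i. Proof. by rewrite /qc mxE. Qed.
Lemma pc_pt q p i : pc (pt q p) i = p i. Proof. by rewrite /pc mxE. Qed.

Lemma sum_delta_cond A k (F : 'I_N -> R) : A k ->
  (forall i, i != k -> F i = 0) -> \sum_(i | A i) F i = F k.
Proof.
move=> Ak F0; rewrite (bigD1 k)//= big1 ?addr0// => i /andP[_ ik].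
exact: F0.
Qed.

(** For [e] in [A] this is half the derivative of [cas A] along p_e. *)
Definition link A (e : 'I_N) x : R := SQ A x * pc x e - SU A x * qc x e.

Lemma generic_link A e f : A f -> e != f -> generic [set x : phase | link A e x != 0].
Proof.
(* At this point [SQ A] = 1, p_e = 1 and q_e = 0, so the link equals 1. *)
move=> Af ef; pose y : phase := pt (fun i => (i == f)%:R) (fun i => (i == e)%:R).
apply: (generic_polyfun _ y).
  by apply: polyfunB; apply: polyfunM;
     [exact: polyfun_SQ|exact: polyfun_pc|exact: polyfun_SU|exact: polyfun_qc].
rewrite /link /SQ (sum_delta_cond _ f)//; last first.
  by move=> i /negbTE fi; rewrite qc_pt fi expr0n.
by rewrite !qc_pt pc_pt !eqxx (negbTE ef) mulr0 subr0 mulr1 expr1n oner_neq0.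
Qed.

Lemma generic_SU (i : 'I_N) : generic [set x : phase | SU T x != 0].
Proof.
pose y : phase := pt (fun j => (j == i)%:R) (fun j => (j == i)%:R).
apply: (generic_polyfun _ y); first exact: polyfun_SU.
rewrite /SU (sum_delta_cond _ i)//; last first.
  by move=> j /negbTE ji; rewrite qc_pt ji mul0r.
by rewrite qc_pt pc_pt eqxx mulr1 oner_neq0.
Qed.

(* The coordinate [e] enters [A m] but no earlier set of the chain, so the
   system is triangular in the derivatives along the momenta of these [e]. *)
Lemma chain_free (A : nat -> pred 'I_N) (b : nat -> R) x :
  (forall m, (2 <= m <= N)%N -> exists e, [/\ A m e, link (A m) e x != 0 &
     forall m', (2 <= m' < m)%N -> ~~ A m' e]) ->
  (forall k, \sum_(2 <= m < N.+1) b m * dp (cas (A m)) k x = 0) ->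
  forall m, (2 <= m <= N)%N -> b m = 0.
Proof.
(* Descending induction on [m]: larger indices are already killed, smaller sets do not contain
   [e]. *)
move=> chain eqs; suff H d m : (2 <= m <= N)%N -> (N - m < d)%N -> b m = 0.
  by move=> m mN; exact: (H (N - m).+1).
elim: d m => // d IH m mN md.
have [e [Ame ne0 nA]] := chain m mN.
have := eqs e; rewrite (bigD1_seq m)/= ?iota_uniq ?mem_index_iota//.
rewrite big_seq_cond big1 => [|m' /andP[]]; last first.
  rewrite mem_index_iota => m'N m'm; have [lt|gt|eq] := ltngtP m' m.
  - by rewrite dp_cas (negbTE (nA m' _)) ?mul0r ?mulr0//; lia.
  - by rewrite IH ?mul0r//; lia.
  - by rewrite eq eqxx in m'm.
rewrite addr0 dp_cas Ame mul1r => /eqP.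
by rewrite !mulf_eq0 -/(link _ _ _) (negbTE ne0) pnatr_eq0 !orbF => /eqP.
Qed.

End Independence.

(** * Eliminating the coefficients *)

Section Superintegrability.
Context {R : realType} {N : nat}.
Variables (lam om : R).
Local Notation phase := (phase R N).
Local Notation T := (@predT 'I_N).
Implicit Types (x : phase) (A : pred 'I_N).

Lemma sum_SU x : \sum_k qc x k * pc x k = SU T x. Proof. by []. Qed.
Lemma sum_SQ x : \sum_k qc x k ^+ 2 = SQ T x. Proof. by []. Qed.
Lemma sum_SP x : \sum_k pc x k ^+ 2 = SP T x. Proof. by []. Qed.

(** The denominator [conf] has been cleared so that the expression is polynomial. *)
Definition fradkin_det i x : R :=
  SU T x * ((lam * SP T x - om ^+ 2) * qc x i ^+ 2
            + (1 + lam * SQ T x) * pc x i ^+ 2)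
  - qc x i * pc x i * ((lam * SP T x - om ^+ 2) * SQ T x
                       + (1 + lam * SQ T x) * SP T x).

(* The fields [q d/dp] and [q d/dq - p d/dp] generate linear canonical maps that
   fix all angular momenta, hence annihilate every [cas A]; they leave a 2x2
   system for the coefficients of [Ham] and [Ifr i i], whose determinant is
   [fradkin_det] up to a nonzero factor. *)
Lemma Ham_Ifr_free i x (a e : R) (dQ dP : 'I_N -> R) :
  conf lam x != 0 -> fradkin_det i x != 0 ->
  \sum_k qc x k * dP k = 0 -> \sum_k (qc x k * dQ k - pc x k * dP k) = 0 ->
  (forall k, a * dq (Ham lam om) k x + dQ k + e * dq (Ifr lam om i i) k x = 0) ->
  (forall k, a * dp (Ham lam om) k x + dP k + e * dp (Ifr lam om i i) k x = 0) ->
  a = 0 /\ e = 0.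
Proof.
move=> W0 Z0 qdP qdQ eQ eP.
set W := conf lam x; set K := curv lam om x; set u := SU T x.
pose m := 2 * lam * qc x i * qc x i / W.
(* [al] is the total coefficient of the direction (- K q_k, p_k), common to the gradients of [Ham]
   and [Ifr i i]; what is left of [Ifr i i] sits at k = i. *)
pose al := a / W - e * m.
have KW : K * W = lam * SP T x - om ^+ 2 by rewrite /K /curv mulfVK.
have eq1 : al * u + 2 * e * (pc x i * qc x i) = 0.
  transitivity (\sum_k ((a / W - e * m) * (qc x k * pc x k)
     + 2 * e * pc x i * qc x k * (k == i)%:R + qc x k * dP k)).
    rewrite !big_split /= qdP addr0 sum_pick -mulr_sumr sum_SU.
    by rewrite /al /u; ring.
  rewrite big1// => k _; rewrite -[RHS](mulr0 (qc x k)) -(eP k).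
  rewrite dp_Ham// dp_Ifr// -/W /m eq_sym; ring.
have eq2 : - al * (K * SQ T x + SP T x)
           - 2 * e * (K * qc x i ^+ 2 + pc x i ^+ 2) = 0.
  transitivity (\sum_k (- al * K * qc x k ^+ 2 + - al * pc x k ^+ 2
     + - 2 * e * (K * qc x i * qc x k + pc x i * pc x k) * (k == i)%:R
     + (qc x k * dQ k - pc x k * dP k))).
    rewrite big_split /= qdQ addr0 !big_split /= sum_pick -!mulr_sumr sum_SQ sum_SP.
    by ring.
  rewrite big1// => k _.
  transitivity (qc x k * 0 - pc x k * 0); last by rewrite !mulr0 subr0.
  rewrite -{1}(eQ k) -(eP k) dp_Ham// dp_Ifr// dq_Ham// dq_Ifr// -/W -/K /al /m.
  by rewrite eq_sym; ring.
have ZE : fradkin_det i x = W * (u * (K * qc x i ^+ 2 + pc x i ^+ 2)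
     - qc x i * pc x i * (K * SQ T x + SP T x)).
  by rewrite /fradkin_det -KW -/u; rewrite -/(conf lam x) -/W; ring.
(* Cramer's rule for [eq1] and [eq2], here and for [e0]. *)
have al0 : al = 0.
  apply: (mulIf Z0); rewrite mul0r ZE.
  transitivity (W * ((K * qc x i ^+ 2 + pc x i ^+ 2) * 0 + qc x i * pc x i * 0)).
    by rewrite -{1}eq1 -eq2; ring.
  by ring.
have e0 : e = 0.
  have: e * (2 * fradkin_det i x) = 0.
    rewrite ZE; transitivity (- W * ((K * SQ T x + SP T x) * 0 + u * 0)).
      by rewrite -{1}eq1 -eq2; ring.
    by ring.
  by move/eqP; rewrite !mulf_eq0 (negbTE Z0) pnatr_eq0 !orbF => /eqP.
split=> //; move: al0; rewrite /al e0 mul0r subr0 => /eqP.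
by rewrite mulf_eq0 invr_eq0 (negbTE W0) orbF => /eqP.
Qed.

Lemma Ham_free x (a : R) (dP : 'I_N -> R) :
  conf lam x != 0 -> SU T x != 0 -> \sum_k qc x k * dP k = 0 ->
  (forall k, a * dp (Ham lam om) k x + dP k = 0) -> a = 0.
Proof.
move=> W0 u0 qdP eP.
have : a * SU T x / conf lam x = 0.
  transitivity (\sum_k (a / conf lam x * (qc x k * pc x k) + qc x k * dP k)).
    by rewrite big_split /= qdP addr0 -mulr_sumr sum_SU; ring.
  rewrite big1// => k _; rewrite -[RHS](mulr0 (qc x k)) -(eP k) dp_Ham//.
  by ring.
by move/eqP; rewrite !mulf_eq0 invr_eq0 (negbTE W0) (negbTE u0) !orbF => /eqP.
Qed.

Lemma generic_fradkin i j : j != i -> generic [set x | fradkin_det i x != 0].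
Proof.
(* The witness q = t e_j, p = e_i + e_j gives t (1 + lam t^2); for lam = -1 the choice t = 2 makes
   the second factor -3. *)
move=> ji; pose t : R := if 1 + lam == 0 then 2 else 1.
have t0 : t != 0 by rewrite /t; case: ifP => _; rewrite ?oner_neq0 ?pnatr_eq0.
have W0 : 1 + lam * t ^+ 2 != 0.
  rewrite /t; case: ifPn => [/eqP l1|]; last by rewrite expr1n mulr1.
  apply/eqP => l4; have : (3 : R) = 0 by nra.
  by move/eqP; rewrite pnatr_eq0.
pose y : phase := pt (fun k => t * (k == j)%:R) (fun k => (k == i)%:R + (k == j)%:R).
have pW : polyfun (fun x : phase => 1 + lam * SQ T x).
  apply: polyfunD; first exact: polyfun_cst.
  by apply: polyfunM; [exact: polyfun_cst | exact: polyfun_SQ].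
have pK : polyfun (fun x : phase => lam * SP T x - om ^+ 2).
  apply: polyfunB; last exact: polyfun_cst.
  by apply: polyfunM; [exact: polyfun_cst | exact: polyfun_SP].
apply: (generic_polyfun _ y).
  apply: polyfunB; apply: polyfunM.
  - exact: polyfun_SU.
  - apply: polyfunD; apply: polyfunM => //; apply: polyfunX;
      [exact: polyfun_qc | exact: polyfun_pc].
  - by apply: polyfunM; [exact: polyfun_qc | exact: polyfun_pc].
  - apply: polyfunD; apply: polyfunM => //;
      [exact: polyfun_SQ | exact: polyfun_SP].
have qi : qc y i = 0 by rewrite qc_pt eq_sym (negbTE ji) mulr0.
have pi : pc y i = 1 by rewrite pc_pt eqxx eq_sym (negbTE ji) addr0.
have Qy : SQ T y = t ^+ 2.
  rewrite /SQ (sum_delta_cond _ j)//; first by rewrite qc_pt eqxx mulr1.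
  by move=> k /negbTE kj; rewrite qc_pt kj mulr0 expr0n.
have Uy : SU T y = t.
  rewrite /SU (sum_delta_cond _ j)//.
    by rewrite qc_pt pc_pt eqxx (negbTE ji) add0r !mulr1.
  by move=> k /negbTE kj; rewrite qc_pt kj mulr0 mul0r.
rewrite /fradkin_det qi pi Qy Uy expr0n expr1n /= !(mulr0, mul0r) mulr1 add0r subr0.
by rewrite mulf_neq0.
Qed.

(** Bilinear form of S_A evaluated at (p_i0, - q_i0) and (p_i1, - q_i1), where [high (N - 1)]
    consists of all indices except 0. *)
Definition first_det (i0 i1 : 'I_N) x : R :=
  let A := high (N - 1) in
  SQ A x * (pc x i0 * pc x i1) - SU A x * (pc x i0 * qc x i1 + qc x i0 * pc x i1)
  + SP A x * (qc x i0 * qc x i1).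

(** Up to sign, the determinant of the two vectors obtained by applying S_A and S_B to (p_j, - q_j);
    [A] holds the indices below j, [B] those from j on. *)
Definition step_det (j : 'I_N) x : R :=
  let A := low j in let B := high (N - j) in
  (SQ A x * pc x j - SU A x * qc x j) * (SP B x * qc x j - SU B x * pc x j)
  - (SQ B x * pc x j - SU B x * qc x j) * (SP A x * qc x j - SU A x * pc x j).

Lemma generic_first_det (i0 i1 : 'I_N) : i0 = 0%N :> nat -> i1 = 1%N :> nat ->
  (2 < N)%N -> generic [set x | first_det i0 i1 x != 0].
Proof.
move=> i00 i11 N2; pose i2 := Ordinal N2.
(* Here p_i0 = q_i1 = 0 and q_i0 = p_i1 = 1, which isolates - [SU]; only [i2] lies in both supports,
   so [SU] = 1. *)
pose y : phase := pt (fun k => (k == i0)%:R + (k == i2)%:R)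
                     (fun k => (k == i1)%:R + (k == i2)%:R).
have neq (k l : 'I_N) : k != l :> nat -> (k == l) = false.
  by move=> /negbTE; rewrite -val_eqE.
apply: (generic_polyfun _ y).
  apply: polyfunD; first apply: polyfunB; apply: polyfunM;
    [exact: polyfun_SQ| |exact: polyfun_SU| |exact: polyfun_SP|].
  - by apply: polyfunM; exact: polyfun_pc.
  - by apply: polyfunD; apply: polyfunM; (exact: polyfun_pc || exact: polyfun_qc).
  - by apply: polyfunM; exact: polyfun_qc.
have -> : first_det i0 i1 y = - SU (high (N - 1)) y.
  rewrite /first_det !qc_pt !pc_pt !eqxx ?neq ?i00 ?i11//=.
  by ring.
rewrite oppr_eq0 /SU (sum_delta_cond _ i2).
- by rewrite qc_pt pc_pt !eqxx !neq ?i00 ?i11//= !add0r mulr1 oner_neq0.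
- by rewrite /high/=; lia.
- move=> k /negbTE k2; rewrite qc_pt pc_pt k2 !addr0.
  case: eqP => [->|_]; last by rewrite mul0r.
  by rewrite neq ?i00 ?i11//= mulr0.
Qed.

Lemma sumr_gt0_at A i (F : 'I_N -> R) : (forall k, A k -> 0 <= F k) ->
  A i -> 0 < F i -> 0 < \sum_(k | A k) F k.
Proof.
move=> F0 Ai Fi; rewrite (bigD1 i)//= ltr_pwDl// sumr_ge0// => k /andP[Ak _].
exact: F0.
Qed.

Lemma generic_step_det (j : 'I_N) : (0 < j)%N -> (j.+1 < N)%N ->
  generic [set x | step_det j x != 0].
Proof.
(* As p_j = 0, the determinant reduces to two products. The signs of k - j on [low j] and
   [high (N - j)] make one positive, thanks to indices 0 and j + 1, and the other nonnegative. *)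
move=> j0 jN; pose y : phase := pt (fun=> 1) (fun k => k%:R - j%:R).
apply: (generic_polyfun _ y).
  by apply: polyfunB; apply: polyfunM; apply: polyfunB; apply: polyfunM;
    (exact: polyfun_SQ || exact: polyfun_SU || exact: polyfun_SP ||
     exact: polyfun_pc || exact: polyfun_qc).
have N0 : (0 < N)%N by exact: ltn_trans jN.
have uA : 0 < - SU (low j) y.
  rewrite -sumrN; apply: (sumr_gt0_at _ (Ordinal N0)) => [k kj| |].
  - by rewrite qc_pt pc_pt mul1r opprB subr_ge0 ler_nat ltnW.
  - by rewrite /low.
  - by rewrite qc_pt pc_pt mul1r opprB subr_gt0 ltr_nat.
have uB : 0 <= SU (high (N - j)) y.
  apply: sumr_ge0 => k; rewrite /high => kj.
  by rewrite qc_pt pc_pt mul1r subr_ge0 ler_nat; lia.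
have pA : 0 <= SP (low j) y by apply: sumr_ge0 => k _; exact: sqr_ge0.
have pB : 0 < SP (high (N - j)) y.
  apply: (sumr_gt0_at _ (Ordinal jN)) => [k _| |].
  - exact: sqr_ge0.
  - by rewrite /high /=; lia.
  - by rewrite pc_pt exprn_gt0// subr_gt0 ltr_nat /=.
have -> : step_det j y = - SU (low j) y * SP (high (N - j)) y
                         + SU (high (N - j)) y * SP (low j) y.
  by rewrite /step_det qc_pt pc_pt subrr; ring.
by rewrite lt0r_neq0// ltr_pwDl ?mulr_gt0// mulr_ge0.
Qed.

End Superintegrability.

(** * Linear relations between the angular momentum integrals *)

Lemma sum_nat_mask {R : realType} (P : pred nat) (F : nat -> R) k l n : (k <= l)%N ->
  (forall m, (k <= m < n)%N -> P m = (l <= m)%N) ->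
  \sum_(k <= m < n) (P m)%:R * F m = \sum_(l <= m < n) F m.
Proof.
move=> kl Pl; rewrite [RHS](big_nat_widenl _ k)// [RHS]big_mkcond.
by apply: eq_big_nat => m /Pl -> /=; case: leqP => _; rewrite ?mul1r ?mul0r.
Qed.

Section AngularIntegrals.
Context {R : realType} {N : nat}.
Local Notation phase := (phase R N).
Variables (x : phase) (i0 i1 : 'I_N) (b c : nat -> R).
Hypotheses (i00 : i0 = 0%N :> nat) (i11 : i1 = 1%N :> nat).
Hypothesis detL : qc x i0 * pc x i1 - qc x i1 * pc x i0 != 0.
Hypothesis det1 : (2 < N)%N -> first_det i0 i1 x != 0.
Hypothesis detS : forall j : 'I_N, (1 < j)%N -> (j.+1 < N)%N ->
  step_det j x != 0.
Hypothesis eq_dp : forall k, \sum_(2 <= m < N.+1) b m * dp (cas (low m)) k x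
                     + \sum_(2 <= m < N) c m * dp (cas (high m)) k x = 0.
Hypothesis eq_dq : forall k, \sum_(2 <= m < N.+1) b m * dq (cas (low m)) k x
                     + \sum_(2 <= m < N) c m * dq (cas (high m)) k x = 0.

(** With [g] equal to [SQ], [SU] or [SP] these are the entries of T_k. The bounds select the sets
    containing k, and [maxn 2] accounts for families that start at m = 2. *)
Definition active (g : pred 'I_N -> R) (k : nat) : R :=
  \sum_(maxn 2 k.+1 <= m < N.+1) b m * g (low m)
  + \sum_(maxn 2 (N - k) <= m < N) c m * g (high m).

Lemma sum_active (g : pred 'I_N -> R) (k : 'I_N) :
  \sum_(2 <= m < N.+1) b m * ((low m k)%:R * g (low m))
  + \sum_(2 <= m < N) c m * ((high m k)%:R * g (high m)) = active g k.
Proof.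
have := ltn_ord k => kN; congr (_ + _).
- rewrite -[RHS](sum_nat_mask (fun m => low m k) _ 2) ?leq_maxl// => [|m mN].
    by apply: eq_bigr => m _; rewrite mulrCA.
  by rewrite /low; lia.
- rewrite -[RHS](sum_nat_mask (fun m => high m k) _ 2) ?leq_maxl// => [|m mN].
    by apply: eq_bigr => m _; rewrite mulrCA.
  by rewrite /high; lia.
Qed.

Lemma active_lin (g h : pred 'I_N -> R) (s t : R) k :
  active (fun A => 2 * (s * g A - t * h A)) k
  = 2 * (s * active g k - t * active h k).
Proof.
have lin (f : nat -> R) (r : seq nat) (d : nat -> pred 'I_N) :
  \sum_(m <- r) f m * (2 * (s * g (d m) - t * h (d m)))
  = 2 * (s * \sum_(m <- r) f m * g (d m) - t * \sum_(m <- r) f m * h (d m)).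
  by rewrite !mulr_sumr -sumrB mulr_sumr; apply: eq_bigr => m _; ring.
by rewrite /active !lin; ring.
Qed.

Let aQ := active (fun A => SQ A x).
Let aU := active (fun A => SU A x).
Let aP := active (fun A => SP A x).

Lemma active_dp (k : 'I_N) : aQ k * pc x k - aU k * qc x k = 0.
Proof.
apply: (@mulfI _ 2); first by rewrite pnatr_eq0.
rewrite mulr0 -(eq_dp k).
have := active_lin (fun A => SQ A x) (fun A => SU A x) (pc x k) (qc x k) k.
rewrite -/aQ -/aU -sum_active [aQ k * _]mulrC [aU k * _]mulrC => <-.
by congr (_ + _); apply: eq_bigr => m _; rewrite dp_cas; ring.
Qed.

Lemma active_dq (k : 'I_N) : aP k * qc x k - aU k * pc x k = 0.
Proof.
apply: (@mulfI _ 2); first by rewrite pnatr_eq0.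
rewrite mulr0 -(eq_dq k).
have := active_lin (fun A => SP A x) (fun A => SU A x) (qc x k) (pc x k) k.
rewrite -/aP -/aU -sum_active [aP k * _]mulrC [aU k * _]mulrC => <-.
by congr (_ + _); apply: eq_bigr => m _; rewrite dq_cas; ring.
Qed.

(** Indices 0 and 1 lie in every [low m] with m at least 2, so only a high term enters. *)
Lemma active_first g : (2 < N)%N ->
  active g 1 = active g 0 + c (N - 1) * g (high (N - 1)).
Proof.
move=> N2; rewrite /active (_ : maxn 2 (N - 1) = (N - 1)%N); last lia.
rewrite (@big_ltn _ _ _ (N - 1)); last lia.
rewrite [X in _ + (_ + X)]big_geq; last lia.
rewrite [X in _ = _ + X + _]big_geq; last lia.
by rewrite !addr0.
Qed.

Lemma active_step g j : (1 < j)%N -> (j.+1 < N)%N ->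
  active g j = active g j.-1 - b j * g (low j)
               + c (N - j) * g (high (N - j)).
Proof.
move=> j1 jN; rewrite /active.
have -> : maxn 2 j.-1.+1 = j by lia.
have -> : maxn 2 j.+1 = j.+1 by lia.
have -> : maxn 2 (N - j) = (N - j)%N by lia.
have -> : maxn 2 (N - j.-1) = (N - j).+1 by lia.
rewrite [in RHS](@big_ltn _ _ _ j); last lia.
rewrite [in LHS](@big_ltn _ _ _ (N - j)); last lia.
by ring.
Qed.

(** Write v_k = (p_k, - q_k). Since T_0 v_0 = 0, T_1 v_1 = 0 and the forms are symmetric, pairing
    with v_1 and v_0 and subtracting leaves [c (N - 1)] times [first_det]. Then T_0 = T_1 kills two
    independent vectors, hence vanishes. *)
Lemma active_first0 : (2 < N)%N ->
  [/\ c (N - 1) = 0, aQ 1 = 0, aU 1 = 0 & aP 1 = 0].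
Proof.
move=> N2; have := (active_dp i0, active_dq i0, active_dp i1, active_dq i1).
rewrite i00 i11 => -[[[E1 E2] E3] E4].
have c0 : c (N - 1) = 0.
  apply: (mulIf (det1 N2)); rewrite mul0r.
  transitivity (pc x i0 * (aQ 1 * pc x i1 - aU 1 * qc x i1)
      + qc x i0 * (aP 1 * qc x i1 - aU 1 * pc x i1)
      - pc x i1 * (aQ 0 * pc x i0 - aU 0 * qc x i0)
      - qc x i1 * (aP 0 * qc x i0 - aU 0 * pc x i0)); last first.
    by rewrite E1 E2 E3 E4 !mulr0 !subr0 addr0.
  by rewrite /aQ /aU /aP !active_first// /first_det; ring.
have eq01 g : active g 1 = active g 0 by rewrite active_first// c0 mul0r addr0.
move: E1 E2 E3 E4; rewrite /aQ /aU /aP !eq01.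
set X := active _ 0; set Y := active _ 0; set Z := active _ 0 => E1 E2 E3 E4.
split=> //; apply: (mulIf detL); rewrite mul0r.
- transitivity (qc x i0 * (X * pc x i1 - Y * qc x i1)
                - qc x i1 * (X * pc x i0 - Y * qc x i0)); first by ring.
  by rewrite E1 E3 !mulr0 subr0.
- transitivity (pc x i0 * (X * pc x i1 - Y * qc x i1)
                - pc x i1 * (X * pc x i0 - Y * qc x i0)); first by ring.
  by rewrite E1 E3 !mulr0 subr0.
- transitivity (pc x i1 * (Z * qc x i0 - Y * pc x i0)
                - pc x i0 * (Z * qc x i1 - Y * pc x i1)); first by ring.
  by rewrite E2 E4 !mulr0 subr0.
Qed.

(** Once T_(j-1) = 0, the relation T_j v_j = 0 is a 2x2 system for [b j] and [c (N - j)] with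
    determinant [step_det] up to sign. *)
Lemma active_step0 j : (1 < j)%N -> (j.+1 < N)%N ->
  aQ j.-1 = 0 -> aU j.-1 = 0 -> aP j.-1 = 0 ->
  [/\ c (N - j) = 0, aQ j = 0, aU j = 0 & aP j = 0].
Proof.
move=> j1 jN Q0 U0 P0; pose k := Ordinal (ltnW jN).
have := (active_dp k, active_dq k); rewrite /aQ /aU /aP /= !(active_step _ j)//.
rewrite -/aQ -/aU -/aP Q0 U0 P0 !sub0r => -[E1 E2].
have D0 := detS k j1 jN.
have c0 : c (N - j) = 0.
  apply: (mulIf D0); rewrite mul0r /step_det /=.
  set A := low j; set B := high (N - j); rewrite -/A -/B in E1 E2.
  transitivity (
    (SQ A x * pc x k - SU A x * qc x k) *
      ((- (b j * SP A x) + c (N - j) * SP B x) * qc x k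
        - (- (b j * SU A x) + c (N - j) * SU B x) * pc x k)
    - (SP A x * qc x k - SU A x * pc x k) *
      ((- (b j * SQ A x) + c (N - j) * SQ B x) * pc x k
        - (- (b j * SU A x) + c (N - j) * SU B x) * qc x k)); first by ring.
  by rewrite E1 E2 !mulr0 subr0.
have b0 : b j = 0.
  apply: (mulIf D0); rewrite mul0r /step_det /=.
  set A := low j; set B := high (N - j); rewrite -/A -/B in E1 E2.
  transitivity (
    (SQ B x * pc x k - SU B x * qc x k) *
      ((- (b j * SP A x) + c (N - j) * SP B x) * qc x k
        - (- (b j * SU A x) + c (N - j) * SU B x) * pc x k)
    - (SP B x * qc x k - SU B x * pc x k) *
      ((- (b j * SQ A x) + c (N - j) * SQ B x) * pc x k
        - (- (b j * SU A x) + c (N - j) * SU B x) * qc x k)); first by ring.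
  by rewrite E1 E2 !mulr0 subr0.
by rewrite b0 c0 !mul0r oppr0 addr0.
Qed.

Lemma high_coeffs0 m : (2 <= m < N)%N -> c m = 0.
Proof.
move=> mN; have N2 : (2 < N)%N by lia.
have H j : (1 <= j)%N -> (j.+1 < N)%N ->
    [/\ c (N - j) = 0, aQ j = 0, aU j = 0 & aP j = 0].
  elim: j => // -[_ _ _|j IH _ jN]; first exact: active_first0.
  have [//|_ Q0 U0 P0] := IH _ (ltnW jN).
  exact: active_step0.
have [||] := H (N - m)%N; try lia.
by rewrite subKn// ltnW//; case/andP: mN.
Qed.

End AngularIntegrals.

(** * The three families and superintegrability *)

Section FunctionalIndependence.
Context {R : realType} {N : nat}.
Variables (lam om : R).
Local Notation phase := (phase R N).
Local Notation T := (@predT 'I_N).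
Local Notation H := (Ham (N:=N) lam om).
Implicit Types (x : phase) (A : nat -> pred 'I_N).

(** The index type is finite, so that [generic_forall] applies; the guard ensures that the link is
    not identically zero. *)
Definition links_nonzero A x : Prop := forall z : 'I_N.+1 * 'I_N,
  [exists f, A z.1 f && (z.2 != f)] -> link (A z.1) z.2 x != 0.

Lemma generic_links_nonzero A : generic [set x | links_nonzero A x].
Proof.
apply: generic_forall => z; apply: generic_imply => /existsP[f /andP[Af ef]].
exact: (generic_link _ _ f).
Qed.

Definition chained A := forall m, (2 <= m <= N)%N ->
  exists e f, [/\ A m e, A m f, e != f &
    forall m', (2 <= m' < m)%N -> ~~ A m' e].

Lemma chained_links_free A (b : nat -> R) x : chained A -> links_nonzero A x ->
  (forall k, \sum_(2 <= m < N.+1) b m * dp (cas (A m)) k x = 0) ->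
  forall m, (2 <= m <= N)%N -> b m = 0.
Proof.
move=> ch lk; apply: chain_free => m mN.
have [e [f [Ae Af ef nA]]] := ch m mN; exists e; split=> //.
have mlt : (m < N.+1)%N by case/andP: mN.
apply: (lk (Ordinal mlt, e)); apply/existsP; exists f => /=.
by rewrite Af.
Qed.

Lemma chained_low : chained low.
Proof.
move=> m mN; have h1 : (m.-1 < N)%N by lia.
have h0 : (0 < N)%N by lia.
exists (Ordinal h1), (Ordinal h0); rewrite /low /=; split=> [|||m' m'm]; try lia.
by rewrite -val_eqE /=; lia.
Qed.

Lemma chained_high : chained high.
Proof.
move=> m mN; have h1 : (N - m < N)%N by lia.
have h0 : (N.-1 < N)%N by lia.
exists (Ordinal h1), (Ordinal h0); rewrite /high /=; split=> [|||m' m'm]; try lia.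
by rewrite -val_eqE /=; lia.
Qed.

Lemma func_indep_chained A : (2 <= N)%N -> chained A ->
  func_indep (phase_space lam) (H :: [seq cas (A m) | m <- iota 2 (N - 1)]).
Proof.
move=> hN ch; pose i0 := Ordinal (ltnW hN).
apply: (func_indep_generic _ _ _
  (genericI _ _ (generic_SU i0) (generic_links_nonzero A))) => x W0 [u0 lk].
apply: row_free_jac => a _ ap.
pose b m := a (m - 2).+1.
have eP k : a 0%N * dp H k x + \sum_(2 <= m < N.+1) b m * dp (cas (A m)) k x = 0.
  by have := ap k; rewrite lincomb_cons lincomb_map_iota (_ : (N - 1 + 2 = N.+1)%N)//; lia.
have a0 : a 0%N = 0.
  apply: (Ham_free lam om x _ _ W0 u0 _ eP).
  under eq_bigr do rewrite mulr_sumr.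
  rewrite exchange_big big1// => m _.
  transitivity (b m * \sum_k qc x k * dp (cas (A m)) k x).
    by rewrite mulr_sumr; apply: eq_bigr => k _; rewrite mulrCA.
  by rewrite sum_q_dp_cas mulr0.
have b0 := chained_links_free A b x ch lk.
move=> [|n] //=; rewrite size_map size_iota => nN.
have := b0 _ n.+2; rewrite /b subn2 /=; apply; last lia.
by move=> k; rewrite -[RHS](eP k) a0 mul0r add0r.
Qed.

(** Momentum derivatives suffice: where no p_k vanishes they force all coefficients to be equal. *)
Lemma func_indep_Ifr :
  func_indep (phase_space lam) [seq Ifr lam om i i | i : 'I_N].
Proof.
have gU : generic [set x : phase | forall k, pc x k != 0].
  apply: generic_forall => k; apply: (generic_polyfun _ (pt (fun=> 0) (fun=> 1))).
    exact: polyfun_pc.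
  by rewrite pc_pt oner_neq0.
apply: (func_indep_generic _ _ _ gU) => x W0 p0.
apply: row_free_jac => a _ ap n; rewrite size_image card_ord => nN.
have sumE (g : (phase -> R) -> R) : lincomb a [seq Ifr lam om i i | i : 'I_N] g =
    \sum_(i < N) a i * g (Ifr lam om i i).
  rewrite /lincomb size_image card_ord big_mkord; apply: eq_bigr => i _.
  have iN : (i < #|'I_N|)%N by rewrite card_ord.
  rewrite (nth_image _ _ (Ordinal iN)) (_ : enum_val _ = i)//.
  by apply: val_inj; rewrite enum_val_ord.
pose S := \sum_(i < N) a i * qc x i ^+ 2.
have aE (k : 'I_N) : a k = lam * S / conf lam x.
  have := ap k; rewrite sumE => E.
  have : pc x k * (2 * (a k - lam * S / conf lam x)) = 0.
    rewrite -E; transitivity (\sum_(i < N) (a i * 2 * pc x i * (i == k)%:R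
        - 2 * lam / conf lam x * pc x k * (a i * qc x i ^+ 2))).
      by rewrite sumrB sum_pick -mulr_sumr -/S; ring.
    by apply: eq_bigr => i _; rewrite dp_Ifr//; ring.
  by move/eqP; rewrite !mulf_eq0 (negbTE (p0 k)) pnatr_eq0 /= subr_eq0 => /eqP.
suff S0 : S = 0 by rewrite (aE (Ordinal nN)) S0 mulr0 mul0r.
(* Inserting the common value into [S] gives [conf] S = lam S [SQ T], and [conf] = 1 + lam [SQ T]
   leaves S = 0. *)
have : S = lam * S / conf lam x * SQ T x.
  by rewrite {1}/S mulr_sumr; apply: eq_bigr => i _; rewrite aE.
move=> /(congr1 ( *%R (conf lam x))) SE.
have : S * 1 = 0; last by rewrite mulr1.
transitivity (conf lam x * S - lam * S * SQ T x); first by rewrite /conf; ring.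
by rewrite SE; field.
Qed.

Lemma func_indep_superintegrable (i : 'I_N) : (2 <= N)%N ->
  func_indep (phase_space lam)
   (H :: [seq cas (low m) | m <- iota 2 (N - 1)]
      ++ [seq cas (high m) | m <- iota 2 (N - 2)] ++ [:: Ifr lam om i i]).
Proof.
move=> hN; pose i0 := Ordinal (ltnW hN); pose i1 := Ordinal hN.
have i01 : i1 != i0 by rewrite -val_eqE.
have [j ji] : exists j : 'I_N, j != i.
  have [->|ii0] := eqVneq i i0; first by exists i1.
  by exists i0; rewrite eq_sym.
have gF := generic_fradkin lam om i j ji.
(* This link factors as q_i0 (q_i0 p_i1 - q_i1 p_i0), so it yields a nonzero angular momentum. *)
have gL : generic [set x : phase | link (pred1 i0) i1 x != 0].
  by apply: (generic_link _ _ i0) => //=.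
have g1 : generic [set x : phase | (2 < N)%N -> first_det i0 i1 x != 0].
  by apply: generic_imply => N2; exact: generic_first_det.
have gS : generic [set x : phase | forall k : 'I_N,
    (1 < k)%N && (k.+1 < N)%N -> step_det k x != 0].
  apply: generic_forall => k; apply: generic_imply => /andP[k1 kN].
  by apply: generic_step_det => //; exact: ltnW.
apply: (func_indep_generic _ _ _ (genericI _ _ gF (genericI _ _ gL (genericI _ _ g1
  (genericI _ _ gS (generic_links_nonzero low)))))).
move=> x W0 [F0 [L0 [d1 [dS lk]]]].
apply: row_free_jac => a aq ap.
set s1 := [seq cas (low m) | m <- _] in aq ap *.
set s2 := [seq cas (high m) | m <- _] in aq ap *.
have sz1 : size s1 = (N - 1)%N by rewrite size_map size_iota.
have sz2 : size s2 = (N - 2)%N by rewrite size_map size_iota.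
(* Position 0 holds [H], then come N - 1 low integrals, N - 2 high ones (m = N would repeat the last
   low one) and [Ifr i i]. *)
pose b m := a (m - 2).+1; pose c m := a (N - 1 + (m - 2)).+1.
pose e := a (N - 1 + (N - 2 + 0)).+1.
pose ang (g : (phase -> R) -> R) : R := \sum_(2 <= m < N.+1) b m * g (cas (low m))
            + \sum_(2 <= m < N) c m * g (cas (high m)).
have sumE g : lincomb a (H :: s1 ++ s2 ++ [:: Ifr lam om i i]) g =
    a 0%N * g H + ang g + e * g (Ifr lam om i i).
  rewrite lincomb_cons !lincomb_cat sz1 sz2 !lincomb_map_iota lincomb_cons.
  rewrite /lincomb big_nil addr0 /ang.
  rewrite (_ : (N - 1 + 2 = N.+1)%N); last lia.
  rewrite (_ : (N - 2 + 2 = N)%N); last lia.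
  by rewrite -!addrA.
have angE (F : 'I_N -> (phase -> R) -> R) :
    (forall A : pred 'I_N, \sum_k F k (cas A) = 0) ->
    \sum_k ang (F k) = 0.
  move=> F_0; rewrite big_split /= !(exchange_big _ (index_enum _)) /=.
  rewrite big1 ?add0r => [|m _]; last by rewrite -mulr_sumr F_0 mulr0.
  by rewrite big1// => m _; rewrite -mulr_sumr F_0 mulr0.
have angZ s g : s * ang g = ang (fun f => s * g f).
  by rewrite mulrDr !mulr_sumr; congr (_ + _); apply: eq_bigr => m _; rewrite mulrCA.
have angB g h : ang g - ang h = ang (fun f => g f - h f).
  rewrite /ang opprD addrACA -!sumrB.
  by congr (_ + _); apply: eq_bigr => m _; rewrite mulrBr.
have [a0 e0] : a 0%N = 0 /\ e = 0.
  apply: (Ham_Ifr_free lam om i x (a 0%N) e (fun k => ang (fun f => dq f k x))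
     (fun k => ang (fun f => dp f k x))) => //.
  - under eq_bigr do rewrite angZ.
    by apply: angE => A; exact: sum_q_dp_cas.
  - under eq_bigr do rewrite !angZ angB.
    by apply: angE => A; exact: sum_qdq_pdp_cas.
  - by move=> k; rewrite -[RHS](aq k) sumE.
  - by move=> k; rewrite -[RHS](ap k) sumE.
have angq k : ang (fun f => dq f k x) = 0.
  by rewrite -[RHS](aq k) sumE a0 e0 !mul0r add0r addr0.
have angp k : ang (fun f => dp f k x) = 0.
  by rewrite -[RHS](ap k) sumE a0 e0 !mul0r add0r addr0.
have c0 m : (2 <= m < N)%N -> c m = 0.
  apply: (high_coeffs0 x i0 i1 b c) => //.
  - apply: contra_neq L0 => L0.
    rewrite /link /SQ /SU !big_pred1_eq.
    by transitivity (qc x i0 * 0); [rewrite -L0; ring | rewrite mulr0].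
  - by move=> k k1 kN; apply: dS; rewrite k1.
(* With the high coefficients gone, the chain of low sets alone remains. *)
have b0 m : (2 <= m <= N)%N -> b m = 0.
  apply: (chained_links_free low b x chained_low lk) => k.
  rewrite -[RHS](angp k) /ang [X in _ = _ + X]big_nat.
  by rewrite [X in _ = _ + X]big1 ?addr0// => l lN; rewrite c0 ?mul0r.
move=> [|n] //; rewrite /= !size_cat sz1 sz2 /= => nN.
have [n1|n1] := ltnP n (N - 1).
  by have := b0 n.+2; rewrite /b subn2 /=; apply; lia.
have [n2|n2] := ltnP n (N - 1 + (N - 2)).
  have := c0 (n - (N - 1) + 2)%N; rewrite /c addnK subnKC//; apply; lia.
by rewrite -e0 /e; congr a; lia.
Qed.

Lemma involution_chained A : (2 <= N)%N ->
  (forall m m', (m <= m')%N -> forall i, A m i -> A m' i) ->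
  in_involution (phase_space lam) (H :: [seq cas (A m) | m <- iota 2 (N - 1)]).
Proof.
move=> hN mono; set S := _ :: _.
have nthS n : (n.+1 < size S)%N -> nth (fun _ => 0) S n.+1 = cas (A n.+2).
  rewrite /S /= size_map size_iota => nN.
  by rewrite (nth_map 0%N) ?size_iota// nth_iota.
move=> [[|a] ha] [[|b] hb] x W0.
- exact: pbracket_self.
- rewrite [nth _ S (Ordinal hb)](nthS b hb).
  exact: (pbracket_Ham_cas lam om (A b.+2) x W0).
- rewrite [nth _ S (Ordinal ha)](nthS a ha) pbracketC -[RHS]oppr0.
  by congr (- _); exact: (pbracket_Ham_cas lam om (A a.+2) x W0).
- rewrite [nth _ S (Ordinal ha)](nthS a ha) [nth _ S (Ordinal hb)](nthS b hb).
  have [ab|ba] := leqP a b.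
    by apply: pbracket_cas_sub; exact: mono.
  by rewrite pbracketC pbracket_cas_sub ?oppr0//; apply: mono; lia.
Qed.

Lemma involution_Ifr :
  in_involution (phase_space lam) [seq Ifr lam om i i | i : 'I_N].
Proof.
move=> a b x W0; have [ha hb] := (ltn_ord a, ltn_ord b).
rewrite [X in (a < X)%N]size_image in ha; rewrite [X in (b < X)%N]size_image in hb.
rewrite (nth_image _ _ (Ordinal ha)) (nth_image _ _ (Ordinal hb)).
exact: pbracket_Ifr_diag.
Qed.

End FunctionalIndependence.

Theorem theorem1 (R : realType) (N : nat) (hN : (2 <= N)%N) (lam om : R) :
  let D := phase_space (N:=N) lam in
  let H := Ham (N:=N) lam om in
  (* (i) constants of motion *)
  ((forall m : nat, (2 <= m <= N)%N -> forall x, D x ->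
      pbracket H (Cup m) x = 0 /\ pbracket H (Clow m) x = 0)
   /\ (forall x : phase R N, Cup N x = Clow N x)
   /\ (forall (i j : 'I_N) x, D x -> pbracket H (Ifr lam om i j) x = 0)
   /\ (forall x, D x -> H x = 2^-1 * \sum_(i < N) Ifr lam om i i x))
  (* (ii) three complete sets in involution *)
  /\ (let S1 := H :: [seq Cup m | m <- iota 2 (N - 1)] in
      let S2 := H :: [seq Clow m | m <- iota 2 (N - 1)] in
      let S3 := [seq Ifr lam om i i | i : 'I_N] in
      [/\ size S1 = N, func_indep D S1 & in_involution D S1] /\
      [/\ size S2 = N, func_indep D S2 & in_involution D S2] /\
      [/\ size S3 = N, func_indep D S3 & in_involution D S3])
  (* (iii) maximal superintegrability *)
  /\ (forall i : 'I_N,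
      let S := H :: [seq Cup m | m <- iota 2 (N - 1)]
                 ++ [seq Clow m | m <- iota 2 (N - 2)]
                 ++ [:: Ifr lam om i i] in
      size S = (2 * N - 1)%N /\ func_indep D S).
Proof.
have CupE : (@Cup R N) = fun m => cas (low m) by apply/funext => m; exact: Cup_cas.
have ClowE : (@Clow R N) = fun m => cas (high m) by apply/funext => m; exact: Clow_cas.
move=> D H; rewrite CupE ClowE.
refine (conj (conj _ (conj _ (conj _ _)))
  (conj (conj (And3 _ _ _) (conj (And3 _ _ _) (And3 _ _ _))) (fun i => conj _ _))).
- by move=> m _ x W0; split; exact: (pbracket_Ham_cas lam om _ x W0).
(* Both [low N] and [high N] contain every index. *)
- move=> x; congr (cas _ x); apply/funext => i.
  by rewrite /low /high ltn_ord subnn leq0n.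
- by move=> i j x W0; exact: (pbracket_Ham_Ifr lam om i j x W0).
- by move=> x W0; exact: (Ham_trace lam om x W0).
- by rewrite /= size_map size_iota; lia.
- by apply: func_indep_chained => //; exact: chained_low.
- by apply: involution_chained => // m m' mm' i; rewrite /low; lia.
- by rewrite /= size_map size_iota; lia.
- by apply: func_indep_chained => //; exact: chained_high.
- by apply: involution_chained => // m m' mm' i; rewrite /high; lia.
- by rewrite size_image card_ord.
- exact: func_indep_Ifr.
- exact: involution_Ifr.
- by rewrite /= !size_cat !size_map !size_iota /=; lia.
- exact: func_indep_superintegrable.
Qed.
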